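(* Let $m\ge 1$, let $T$ be the $m$-adic rooted tree, and let $G\le\mathrm{Aut}~T$ be a super strongly fractal profinite group (i.e. a closed subgroup of $\mathrm{Aut}~T$ which is super strongly fractal). Then $G$ contains a hypercyclic automorphism, i.e. there exists $g\in G$ with $\overline{\{g|_v : v\in T\}}=G$.
   Context: The $m$-adic tree $T$ is identified with the free monoid of finite words over $\{1,\dots,m\}$ (root = empty word, children of $v$ are $vx$, $x\in\{1,\dots,m\}$); the $n$th level is the set of words of length $n$. $\mathrm{Aut}~T$ is the group of root-fixing, adjacency-preserving bijections of the vertices, acting on the right as $v\mapsto v^g$. For $g\in\mathrm{Aut}~T$, $v\in T$, the section $g|_v\in\mathrm{Aut}~T$ is the unique automorphism with $(vu)^g=v^gu^{g|_v}$ for all $u\in T$. $\mathrm{St}(n)$ is the subgroup fixing all vertices of level $n$; $\mathrm{Aut}~T$ is profinite with the congruence topology, for which $\{\mathrm{St}(n)\}_{n\ge1}$ is a neighborhood basis of the identity, and overlines denote closure in this topology. $\mathrm{St}_G(n)=\mathrm{St}(n)\cap G$; $\mathrm{st}(v)$ is the stabilizer of $v$, and $\varphi_v:\mathrm{st}(v)\to\mathrm{Aut}~T$ is $g\mapsto g|_v$. $G$ is self-similar if $g|_v\in G$ for all $g\in G,v\in T$; $G$ is super strongly fractal if it is self-similar and $\varphi_v(\mathrm{St}_G(n))=G$ for every $n\ge1$ and every vertex $v$ at level $n$ (level-transitivity is not assumed). An element $g$ of a self-similar closed subgroup $G$ is hypercyclic in $G$ if $\overline{\{g|_v: v\in T\}}=G$.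 *)

(* Defs.v *)
From HB Require Import structures.
From mathcomp Require Import all_boot all_order all_algebra.
From mathcomp Require Import all_classical.
From mathcomp Require Import topology zify.

Set Implicit Arguments.
Unset Strict Implicit.
Unset Printing Implicit Defensive.

Local Open Scope classical_set_scope.

Definition word (m : nat) := seq 'I_m.

Definition tree_adj (m : nat) : rel (word m) :=
  fun u v => [exists x, v == rcons u x] || [exists x, u == rcons v x].

(* Automorphisms act on the right: [g v] is the vertex usually written v^g, and
   [g * h] below is "first g, then h". *)
Record tree_aut (m : nat) := TreeAut {
  aut_fun :> word m -> word m;
  aut_bij : bijective aut_fun;
  aut_root : aut_fun [::] = [::];
  aut_adj : {mono aut_fun : u v / tree_adj u v}
}.

Lemma tree_autP (m : nat) (g h : tree_aut m) : g =1 h -> g = h.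
Proof.
case: g => f b r a; case: h => f' b' r' a' /= /funext ff.
by subst f'; congr TreeAut; exact: Prop_irrelevance.
Qed.

HB.instance Definition _ (m : nat) := gen_eqMixin (tree_aut m).
HB.instance Definition _ (m : nat) := gen_choiceMixin (tree_aut m).

Section Group.
Variable m : nat.
Implicit Types g h k : tree_aut m.

Definition aut_one : tree_aut m.
Proof. by exists id => //; exists id. Defined.

Definition aut_mul g h : tree_aut m.
Proof.
exists (h \o g).
- exact: bij_comp (aut_bij h) (aut_bij g).
- by rewrite /= !aut_root.
- by move=> u v; rewrite /= !aut_adj.
Defined.

Lemma aut_inv_ex g : exists f, cancel g f /\ cancel f g.
Proof. by case: (aut_bij g) => f gf fg; exists f. Qed.

Definition aut_inv_fun g : word m -> word m := projT1 (cid (aut_inv_ex g)).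

Lemma aut_funK g : cancel g (aut_inv_fun g).
Proof. by rewrite /aut_inv_fun; case: cid => f []. Qed.

Lemma aut_inv_funK g : cancel (aut_inv_fun g) g.
Proof. by rewrite /aut_inv_fun; case: cid => f []. Qed.

Definition aut_inv g : tree_aut m.
Proof.
exists (aut_inv_fun g).
- exact: Bijective (@aut_inv_funK g) (@aut_funK g).
- by rewrite -{1}(aut_root g) aut_funK.
- by move=> u v; rewrite -(aut_adj g) !aut_inv_funK.
Defined.

Fact aut_mulA : associative aut_mul.
Proof. by move=> g h k; apply: tree_autP. Qed.

Fact aut_mul1g : left_id aut_one aut_mul.
Proof. by move=> g; apply: tree_autP. Qed.

Fact aut_mulg1 : right_id aut_one aut_mul.
Proof. by move=> g; apply: tree_autP. Qed.

Fact aut_mulVg : left_inverse aut_one aut_inv aut_mul.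
Proof. by move=> g; apply: tree_autP => v /=; exact: aut_inv_funK. Qed.

Fact aut_mulgV : right_inverse aut_one aut_inv aut_mul.
Proof. by move=> g; apply: tree_autP => v /=; exact: aut_funK. Qed.

HB.instance Definition _ := isGroup.Build (tree_aut m)
  aut_mulA aut_mul1g aut_mulg1 aut_mulVg aut_mulgV.

Lemma aut1E (v : word m) : (1%g : tree_aut m) v = v.
Proof. by []. Qed.

Lemma autME g h (v : word m) : (g * h)%g v = h (g v).
Proof. by []. Qed.

End Group.

Definition level_stab (m n : nat) : set (tree_aut m) :=
  [set g | forall v : word m, size v = n -> g v = v].
Arguments level_stab : clear implicits.

Section Sections.
Variable m : nat.
Implicit Types (g : tree_aut m) (u v w : word m).

Lemma tree_adj_rcons v x : tree_adj v (rcons v x).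
Proof. by apply/orP; left; apply/existsP; exists x. Qed.

Lemma tree_adj_cat v : {mono cat v : a b / tree_adj a b}.
Proof.
move=> a b; congr (_ || _); apply: eq_existsb => x;
  by rewrite rcons_cat eqseq_cat // eqxx.
Qed.

Lemma aut_rcons g v x : exists y, g (rcons v x) = rcons (g v) y.
Proof.
elim/last_ind: v x => [|v z IHv] x.
  have := tree_adj_rcons [::] x; rewrite -(aut_adj g) aut_root.
  case/orP=> /existsP[y /eqP e]; first by exists y.
  by case: (g _) e.
have := tree_adj_rcons (rcons v z) x; rewrite -(aut_adj g).
case/orP=> /existsP[y /eqP e]; first by exists y.
have [y' e'] := IHv z; move: e; rewrite e' => /rcons_inj[e _].
have /(congr1 size) := bij_inj (aut_bij g) e.
by rewrite !size_rcons; lia.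
Qed.

Lemma size_aut g v : size (g v) = size v.
Proof.
elim/last_ind: v => [|v x IH]; first by rewrite aut_root.
by have [y ->] := aut_rcons g v x; rewrite !size_rcons IH.
Qed.

Lemma aut_cat g v u : g (v ++ u) = g v ++ drop (size v) (g (v ++ u)).
Proof.
rewrite -[LHS](cat_take_drop (size v)); congr (_ ++ _).
elim/last_ind: u => [|u x IH].
  by rewrite cats0 take_oversize // size_aut.
rewrite -rcons_cat; have [y ->] := aut_rcons g (v ++ u) x.
by rewrite -cats1 takel_cat // size_aut size_cat leq_addr.
Qed.

Definition aut_section_fun g v : word m -> word m :=
  fun u => drop (size v) (g (v ++ u)).

Lemma aut_section_funE g v u : g v ++ aut_section_fun g v u = g (v ++ u).
Proof. by rewrite -aut_cat. Qed.

Definition aut_section g v : tree_aut m.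
Proof.
exists (aut_section_fun g v).
- exists (aut_section_fun (g^-1)%g (g v)) => u.
  + rewrite {1}/aut_section_fun aut_section_funE -autME mulgV aut1E size_aut.
    by rewrite drop_size_cat.
  + have := aut_section_funE (g^-1)%g (g v) u.
    rewrite -[X in X ++ _]autME mulgV aut1E /aut_section_fun => ->.
    by rewrite -autME mulVg aut1E drop_size_cat // size_aut.
- by rewrite /aut_section_fun cats0 drop_oversize // size_aut.
- move=> a b; rewrite -(tree_adj_cat (g v)) !aut_section_funE.
  by rewrite aut_adj tree_adj_cat.
Defined.

Lemma aut_section_cat g v u : g (v ++ u) = g v ++ aut_section g v u.
Proof. by rewrite -[LHS]aut_section_funE. Qed.

Lemma aut_section_unique g v (s : tree_aut m) :
  (forall u, g (v ++ u) = g v ++ s u) -> s = aut_section g v.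
Proof.
move=> sP; apply: tree_autP => u; have := sP u.
by rewrite aut_section_cat => /eqP; rewrite eqseq_cat // eqxx => /eqP.
Qed.

End Sections.

(* The congruence topology: the neighborhoods of g are the sets containing a
   coset g St(n) with n >= 1. *)
Section CongruenceTopology.
Variable m : nat.
Implicit Types g h : tree_aut m.

Definition congruence_nbhs g : set_system (tree_aut m) :=
  [set A | exists2 n, (0 < n)%N &
     forall h, level_stab m n (g^-1 * h)%g -> A h].

HB.instance Definition _ := hasNbhs.Build (tree_aut m) congruence_nbhs.

Lemma level_stab1 n : level_stab m n 1%g.
Proof. by []. Qed.

Lemma level_stabM n g h :
  level_stab m n g -> level_stab m n h -> level_stab m n (g * h)%g.
Proof. by move=> gn hn v vn; rewrite autME gn // hn. Qed.

Lemma level_stab_leq n p g : (0 < m)%N -> (n <= p)%N ->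
  level_stab m p g -> level_stab m n g.
Proof.
move=> m0 np gp v vn.
pose w : word m := nseq (p - n) (Ordinal m0).
have /gp : size (v ++ w) = p by rewrite size_cat size_nseq vn subnKC.
by rewrite aut_section_cat => /eqP; rewrite eqseq_cat ?size_aut // => /andP[/eqP].
Qed.

Fact congruence_nbhs_filter g : ProperFilter (congruence_nbhs g).
Proof.
split; first by case=> n _ /(_ g); apply; rewrite mulVg.
split.
- by exists 1%N.
- move=> A B [n n0 An] [p p0 Bp].
  have [m0|] := ltnP 0 m; last first.
    rewrite leqn0 => /eqP m0; exists 1%N => // h _; subst m.
    have E : h = g.
      apply: tree_autP => v; case: v => [|[]//]; by rewrite !aut_root.
    by rewrite E; split; [apply: An | apply: Bp]; rewrite mulVg.
  exists (maxn n p) => [|h H]; first by rewrite leq_max n0.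
  by split; [apply: An | apply: Bp]; apply: level_stab_leq H => //;
    rewrite ?leq_maxl ?leq_maxr.
- by move=> A B AB [n n0 An]; exists n => // h /An /AB.
Qed.

Fact congruence_nbhs_singleton g (A : set (tree_aut m)) :
  congruence_nbhs g A -> A g.
Proof. by case=> n _; apply; rewrite mulVg. Qed.

Fact congruence_nbhs_nbhs g (A : set (tree_aut m)) :
  congruence_nbhs g A -> congruence_nbhs g (congruence_nbhs^~ A).
Proof.
case=> n n0 An; exists n => // h gh; exists n => // k hk; apply: An.
rewrite (_ : g^-1 * k = g^-1 * h * (h^-1 * k))%g; first exact: level_stabM.
by rewrite mulgA mulgK.
Qed.

HB.instance Definition _ := Nbhs_isNbhsTopological.Build (tree_aut m)
  congruence_nbhs_filter congruence_nbhs_singleton congruence_nbhs_nbhs.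

End CongruenceTopology.

Definition self_similar (m : nat) (G : set (tree_aut m)) : Prop :=
  forall g v, G g -> G (aut_section g v).

(* Since [level_stab m n] fixes every word v of length n, it lies in the domain
   st(v) of the homomorphism phi_v, which is [aut_section ^~ v] on st(v). *)
Definition super_strongly_fractal (m : nat) (G : set (tree_aut m)) : Prop :=
  self_similar G /\
  forall (n : nat) (v : word m), (0 < n)%N -> size v = n ->
    [set aut_section g v | g in G `&` level_stab m n] = G.

Definition hypercyclic (m : nat) (G : set (tree_aut m)) (g : tree_aut m) : Prop :=
  G g /\ closure [set aut_section g v | v in [set: word m]] = G.

(* Main.v *)
Require Import Defs.
From mathcomp Require Import all_boot all_order all_algebra.
From mathcomp Require Import all_classical.
From mathcomp Require Import topology.

(** A hypercyclic element must have, for every [h] in [G] and every [n], some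
    section that acts as [h] on level [n].  The levels are finite, so countably
    many pairs [(h, n)] represent all these requirements ([dense_enumeration]).
    They are met one after another: in a super strongly fractal group
    the section of an element at a vertex of any level [N > 0] can be prescribed
    without changing its action on the first [N] levels ([prescribe_section]).  Meeting
    the requirement [(h, n)] at level [N] depends on the first [N + n] levels
    only, so it is not destroyed if all later changes take place below level
    [N + n].  The successive approximations stabilise on every level; their
    limit is an automorphism ([limit_ex]), lies in [G] because [G] is closed,
    and meets all the requirements ([sections_ex]). *)

Set Implicit Arguments.
Unset Strict Implicit.
Unset Printing Implicit Defensive.

Local Open Scope classical_set_scope.

Definition agree (m n : nat) (g h : tree_aut m) : Prop :=
  forall v : word m, (size v <= n)%N -> g v = h v.

Section Agree.
Variable m : nat.
Implicit Types (g h k : tree_aut m) (v : word m).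

Lemma agree_sym n g h : agree n g h -> agree n h g.
Proof. by move=> gh v vn; rewrite gh. Qed.

Lemma agree_trans n g h k : agree n g h -> agree n h k -> agree n g k.
Proof. by move=> gh hk v vn; rewrite gh // hk. Qed.

Lemma agree_leq n p g h : (n <= p)%N -> agree p g h -> agree n g h.
Proof. by move=> np gh v vn; apply: gh; exact: leq_trans np. Qed.

Lemma agree_level_stab n g h : agree n g h -> level_stab m n (g^-1 * h)%g.
Proof.
move=> gh v vn; rewrite autME -gh; first by rewrite -autME mulVg.
by rewrite size_aut vn.
Qed.

Lemma agree_mul_stab n g s : (0 < m)%N -> level_stab m n s ->
  agree n g (s * g)%g.
Proof.
by move=> m0 sn v vn; rewrite autME (level_stab_leq m0 vn sn).
Qed.

Lemma agree_section n v g h : agree (size v + n) g h ->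
  agree n (aut_section g v) (aut_section h v).
Proof.
move=> gh u un; have := gh (v ++ u); rewrite size_cat leq_add2l => /(_ un).
rewrite !aut_section_cat => /eqP; rewrite eqseq_cat ?size_aut //.
by case/andP => _ /eqP.
Qed.

Lemma aut_sectionM g h v :
  aut_section (g * h)%g v = (aut_section g v * aut_section h (g v))%g.
Proof.
by symmetry; apply: aut_section_unique => u; rewrite !autME !aut_section_cat.
Qed.

(** [Aut T] is complete: each value of the limit, and of its inverse, is read
    off at a stage that depends only on the length of the word, and any finitely
    many values are those of one single automorphism of the sequence. *)
Lemma limit_ex (N : nat -> nat) (a : nat -> tree_aut m) :
  (forall i, (i <= N i)%N) -> {homo N : i j / (i <= j)%N} ->
  (forall i, agree (N i) (a i) (a i.+1)) ->
  exists g, forall i, agree (N i) g (a i).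
Proof.
move=> leN homoN aS.
have aE i j : (i <= j)%N -> agree (N i) (a i) (a j).
  move=> /subnKC <-; elim: (j - i)%N => [|d IH]; first by rewrite addn0.
  by rewrite addnS; apply: agree_trans IH (agree_leq (homoN _ _ (leq_addr _ _)) (aS _)).
pose f v := a (size v) v; pose f' v := ((a (size v))^-1)%g v.
have fE i v : (size v <= N i)%N -> f v = a i v.
  move=> vi; have [le_vi|/ltnW le_iv] := leqP (size v) i.
    by apply: (aE _ _ le_vi); exact: leN.
  by rewrite /f -(aE _ _ le_iv).
have f_bij : bijective f.
  exists f' => v; rewrite /f /f' size_aut -autME ?mulgV //.
  by rewrite mulVg.
have f_root : f [::] = [::] by rewrite /f aut_root.
have f_adj : {mono f : u v / tree_adj u v}.
  move=> u v; pose i := maxn (size u) (size v).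
  rewrite !(fE i) ?aut_adj //; apply: leq_trans (leN i);
    by rewrite ?leq_maxl ?leq_maxr.
by exists (TreeAut f_bij f_root f_adj) => i v; exact: fE.
Qed.

End Agree.

Section Hypercyclic.
Variables (m : nat) (G : set (tree_aut m)).
Hypothesis m_gt0 : (0 < m)%N.

Lemma closed_limit (N : nat -> nat) (a : nat -> tree_aut m) g : closed G ->
  (forall i, (i <= N i)%N) -> (forall i, G (a i)) ->
  (forall i, agree (N i) g (a i)) -> G g.
Proof.
move=> cG leN Ga ga; apply: cG => B [n _ nB].
exists (a n); split; first exact: Ga.
exact/nB/agree_level_stab/(agree_leq (leN n)).
Qed.

(** The action of an automorphism on the words of length at most [n] is
    determined by its action on level [n], hence by a finite function; the pairs
    of a level and such a function form a countable type, and one element of [G]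
    is chosen for each of them that [G] realises.  The identity stands in for
    the others, so that the enumeration never leaves [G]. *)
Lemma dense_enumeration : G 1%g ->
  exists (n : nat -> nat) (h : nat -> tree_aut m), (forall k, G (h k)) /\
    forall p g, G g -> exists2 k, n k = p & agree p g (h k).
Proof.
move=> G1.
pose action := {p : nat & {ffun p.-tuple 'I_m -> p.-tuple 'I_m}}.
pose realises (c : action) : set (tree_aut m) :=
  [set g | G g /\ forall t, val (tagged c t) = g (val t)].
pose code k : action := odflt (Tagged _ [ffun t : 0.-tuple 'I_m => t]) (unpickle k).
exists (fun k => tag (code k)), (fun k => xget 1%g (realises (code k))).
split=> [k|p g Gg]; first by case: xgetP => [g _ []|].
pose c : action := Tagged (fun p => {ffun p.-tuple 'I_m -> p.-tuple 'I_m})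
  [ffun t : p.-tuple 'I_m => insubd t (g t)].
have cE t : val (tagged c t) = g (val t).
  by rewrite ffunE val_insubd size_aut size_tuple eqxx.
exists (pickle c); rewrite /code pickleK //=.
case: xgetP => [h _ [_ hE]|/(_ g)]; last by case.
have gh : level_stab m p (g^-1 * h)%g.
  move=> v vp; have wp : size (g^-1 v)%g == p by rewrite size_aut vp.
  by rewrite autME -(hE (Tuple wp)) cE -[LHS]/((g^-1 * g)%g v) mulVg.
by move=> v vp; rewrite -[h](mulVKg g) autME (level_stab_leq m_gt0 vp gh) ?size_aut.
Qed.

(** By the product rule for sections, multiplying [g] on the left by an [s] that
    fixes [v] multiplies the section at [v] on the left by that of [s], which may
    be any element of [G]. *)
Lemma prescribe_section N g h : group_closed [in G] ->
  super_strongly_fractal G -> (0 < N)%N -> G g -> G h ->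
  exists g', [/\ G g', agree N g g' &
    exists2 v, size v = N & aut_section g' v = h].
Proof.
move=> sG [ssG fG] N0 Gg Gh.
have GM x y : G x -> G y -> G (x * y)%g.
  by move=> /mem_set Gx /mem_set Gy; apply: set_mem; exact: (group_closedM sG).
have GV x : G x -> G (x^-1)%g.
  by move=> /mem_set Gx; apply: set_mem; exact: (group_closedV sG).
pose v : word m := nseq N (Ordinal m_gt0).
have vN : size v = N by rewrite size_nseq.
have : G (h * (aut_section g v)^-1)%g by apply: GM => //; exact/GV/ssG.
rewrite -{1}(fG N v N0 vN) => -[s [Gs sN] sv].
exists (s * g)%g; split; [exact: GM | exact: agree_mul_stab |].
by exists v => //; rewrite aut_sectionM (sN v vN) sv mulgVK.
Qed.

(** The level [N i.+1] bounds the words that the first [i.+1] requirements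
    involve: the vertex at level [N i] used for the [i]-th one, extended by words
    of length at most [n i].  The additional successor keeps [N] strictly
    increasing, so that the limit exists even if some [n i] vanish. *)
Lemma sections_ex (n : nat -> nat) (h : nat -> tree_aut m) :
  group_closed [in G] -> closed G -> super_strongly_fractal G ->
  (forall i, G (h i)) ->
  exists2 g, G g & forall i, exists v, agree (n i) (h i) (aut_section g v).
Proof.
move=> sG cG fG Gh.
pose fix N i := if i is j.+1 then (N j + (n j).+1)%N else 1%N.
have N_gt0 i : (0 < N i)%N by case: i => //= i; rewrite addnS.
have leN i : (i <= N i)%N.
  elim: i => //= i IH; rewrite addnS ltnS; exact: leq_trans IH (leq_addr _ _).
have homoN : {homo N : i j / (i <= j)%N}.
  by apply: homo_leq leqnn leq_trans _ => i; exact: leq_addr.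
have step (x : nat * {g | G g}) : exists y : {g | G g},
    agree (N x.1) (sval x.2) (sval y) /\
    exists2 v, size v = N x.1 & aut_section (sval y) v = h x.1.
  case: x => i [g Gg] /=.
  have [g' [Gg' gg' vP]] := prescribe_section sG fG (N_gt0 i) Gg (Gh i).
  by exists (exist _ g' Gg').
have [next nextP] := choice step.
pose fix b i := if i is j.+1 then next (j, b j) else exist _ (h 0) (Gh 0).
have [g gP] := limit_ex leN homoN (fun i => (nextP (i, b i)).1).
exists g => [|i].
  by apply: closed_limit cG leN _ gP => i; exact: svalP.
have [_ [v vN vP]] := nextP (i, b i); exists v.
rewrite -[h i]vP; apply/agree_sym/agree_section.
by rewrite vN; apply: agree_leq (gP i.+1); rewrite leq_add2l.
Qed.

End Hypercyclic.

Theorem corollary2 (m : nat) (hm : (0 < m)%N) (G : set (tree_aut m))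
    (G_subgroup : group_closed [in G]) (G_closed : closed G)
    (G_fractal : super_strongly_fractal G) :
  exists g : tree_aut m, hypercyclic G g.
Proof.
have G1 : G 1%g by apply: set_mem; case: G_subgroup.
have [n [h [Gh h_dense]]] := dense_enumeration hm G1.
have [g Gg gP] := sections_ex hm n G_subgroup G_closed G_fractal Gh.
exists g; split=> //; apply/seteqP; split=> [f|f Gf B [p _]].
  move=> f_cl; apply: G_closed; apply: closure_subset f_cl => _ [v _ <-].
  exact: (proj1 G_fractal).
have [i <- fh] := h_dense p f Gf => iB; have [v hv] := gP i.
exists (aut_section g v); split; first by exists v.
exact/iB/agree_level_stab/(agree_trans fh).
Qed.
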